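(* Let $k\ge 1$ and let $F_1,\dots,F_k$ and $G_1,\dots,G_k$ be two $k$-tuples of hyperplanes in $\mathbb{P}^4$ (over $\mathbb{C}$), with equations $F_i=(f_i=0)$, $G_j=(g_j=0)$, such that every intersection $\Pi_{ij}=F_i\cap G_j$ ($1\le i,j\le k$) is a plane. Let $\sigma\in S_k$ be a permutation and suppose that the $k$ planes $\Pi_{i,\sigma(i)}$, $i=1,\dots,k$, are all contained in a hyperplane $H=(h=0)$. Assume moreover that $H\neq F_i$ and $H\neq G_{\sigma(i)}$ for every $i$. Then, after rescaling the linear forms $f_i$ and $g_{\sigma(i)}$ by nonzero constants, one may write $$h=f_i+g_{\sigma(i)}\qquad\text{for all } i=1,\dots,k.$$ With this normalization, the form $\prod_{i=1}^k f_i-(-1)^k\prod_{j=1}^k g_j$ is divisible by $h$. Hence $$X_\sigma:\quad \frac{\prod_{i=1}^k f_i-(-1)^k\prod_{j=1}^k g_j}{h}=0$$ is a hypersurface of degree $k-1$ in $\mathbb{P}^4$ (that is, the quotient is a nonzero form of degree $k-1$), and it contains all residual planes $\Pi_{ij}=F_i\cap G_j$ with $j\neq\sigma(i)$.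
   Context: $\mathbb{P}^4$ is complex projective 4-space; a plane is a 2-dimensional linear subspace, a hyperplane a 3-dimensional linear subspace. $S_k$ is the symmetric group on $\{1,\dots,k\}$. A form is a homogeneous polynomial in the homogeneous coordinates of $\mathbb{P}^4$; the $f_i$, $g_j$, $h$ are nonzero linear forms. *)

(* Defs.v *)
From HB Require Import structures.
From mathcomp Require Import all_boot all_order all_algebra all_fingroup.
From mathcomp Require Import classical_sets reals.
From mathcomp Require Import complex mpoly.

Set Implicit Arguments.
Unset Strict Implicit.
Unset Printing Implicit Defensive.

Import GRing.Theory.
Local Open Scope ring_scope.
Local Open Scope classical_set_scope.

(* A point of P^n is a line through the origin of K^(n+1). *)
Definition proj_space (K : fieldType) (n : nat) : Type :=
  {L : {vspace 'rV[K]_n.+1} | \dim L == 1%N}.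

Definition hcoord (K : fieldType) (n : nat) (x : proj_space K n)
    (v : 'rV[K]_n.+1) : Prop :=
  v \in val x /\ v != 0.

(* d is the projective dimension, so the underlying vector space has
   dimension d + 1. *)
Definition linear_subspace (K : fieldType) (n d : nat)
    (A : set (proj_space K n)) : Prop :=
  exists W : {vspace 'rV[K]_n.+1},
    \dim W = d.+1 /\ A = [set x | (val x <= W)%VS].

Definition plane (K : fieldType) (n : nat) (A : set (proj_space K n)) : Prop :=
  linear_subspace 2 A.

Definition hyperplane (K : fieldType) (A : set (proj_space K 4)) : Prop :=
  linear_subspace 3 A.

Definition is_form (K : fieldType) (n d : nat) (p : {mpoly K[n]}) : Prop :=
  p \is d.-homog /\ p != 0.

(* For a homogeneous p, vanishing at x does not depend on the choice of the
   homogeneous coordinates of x. *)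
Definition zero_locus (K : fieldType) (n : nat) (p : {mpoly K[n.+1]}) :
    set (proj_space K n) :=
  [set x | forall v, hcoord x v -> p.@[fun i => v ord0 i] = 0].

(* b is indexed by j = s i. *)
Definition normalization (K : fieldType) (n k : nat) (s : 'S_k)
    (f g : 'I_k -> {mpoly K[n]}) (h : {mpoly K[n]}) (a b : 'I_k -> K) : Prop :=
  [/\ forall i, a i != 0, forall j, b j != 0
    & forall i, h = a i *: f i + b (s i) *: g (s i)].

(* Main.v *)
Require Import Defs.
From HB Require Import structures.
From mathcomp Require Import all_boot all_order all_algebra all_fingroup.
From mathcomp Require Import classical_sets reals.
From mathcomp Require Import complex mpoly.

(** Every hypothesis on the planes turns into linear algebra on the forms.
    Since [h] vanishes where [f i] and [g (s i)] do, it is a combination of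
    the two ([linear_form_comb]).  Both coefficients are nonzero: otherwise
    [h] would be proportional to one of the two forms and [H] equal to one of
    the two hyperplanes.

    Put [x i = a i *: f i] and [y i = - b (s i) *: g (s i)], so that
    [x i - y i = h] for every [i].  Reindexing the [g]'s by [s], the form of
    the statement is the difference of the products of the [x i] and of the
    [y i].  Replacing the [y i] by the [x i] one at a time shows that it is
    [h] times an explicit sum of products of [k - 1] linear forms
    ([prodrB_telescoping]), which is the quotient.

    The quotient is nonzero because the difference is already nonzero on
    [F i0] for any index [i0]: there the product of the [f i] vanishes, while
    no [g j] vanishes identically, because otherwise the plane cut out by
    [F i0] and [G j] would be all of [F i0].  Restricting polynomials to
    [F i0] is a ring morphism to an integral domain ([restrict_to_zeros]), so
    the product of the [g j] does not vanish identically there.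

    At a point of a residual plane both products vanish, hence so does the
    quotient as long as [h] does not.  A residual plane can meet [H], or even
    be contained in it; at a point where [h] vanishes, [x] and [y] agree and
    they vanish at the two distinct indices [i] and [s^-1 j], and each term of
    the explicit quotient contains one of them
    ([telescoping_quotient_eq0]). *)

Set Implicit Arguments.
Unset Strict Implicit.
Unset Printing Implicit Defensive.

Import GRing.Theory.
Local Open Scope ring_scope.
Local Open Scope classical_set_scope.

(** * Quotient of a difference of products *)

(** The telescoping quotient, which turns into the quotient of
    X^k - Y^k by X - Y when [x] and [y] are constant.  An explicit formula is
    needed because the quotient has to be evaluated where the divisor
    vanishes. *)
Definition telescoping_quotient (A : comNzRingType) (k : nat)
    (x y : 'I_k -> A) : A :=
  \sum_(m < k) \prod_(l < k | l != m) (if (l < m)%N then x l else y l).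

(** Replace the factors [y l] by [x l] one at a time: the [m]-th replacement
    changes the product by [x m - y m = c] times the other factors. *)
Lemma prodrB_telescoping (A : comNzRingType) (k : nat) (x y : 'I_k -> A)
    (c : A) :
  (forall i, x i - y i = c) ->
  \prod_(i < k) x i - \prod_(i < k) y i = telescoping_quotient x y * c.
Proof.
move=> xyc; pose T j := \prod_(l < k) (if (l < j)%N then x l else y l).
have -> : \prod_(i < k) x i = T k by apply: eq_bigr => i _; rewrite ltn_ord.
have -> : \prod_(i < k) y i = T 0%N by [].
rewrite -telescope_sumr // big_mkord mulr_suml; apply: eq_bigr => m _.
rewrite /T (bigD1 m) //= [X in _ - X](bigD1 m) //= ltnSn ltnn.
under eq_bigr => l lm do
  rewrite ltnS leq_eqVlt (inj_eq val_inj) (negPf lm) /=.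
by rewrite -mulrBl xyc mulrC.
Qed.

(** Each summand omits a single index, so it keeps a vanishing factor as soon
    as two indices carry one. *)
Lemma telescoping_quotient_eq0 (A : comNzRingType) (k : nat)
    (x y : 'I_k -> A) (i j : 'I_k) :
  i != j -> x i = 0 -> y i = 0 -> x j = 0 -> y j = 0 ->
  telescoping_quotient x y = 0.
Proof.
move=> ij xi yi xj yj; apply: big1 => m _.
have [im|mi] := eqVneq i m.
  by rewrite (bigD1 j) /= ?xj ?yj ?if_same ?mul0r // -im eq_sym.
by rewrite (bigD1 i) //= xi yi if_same mul0r.
Qed.

Lemma rmorph_telescoping_quotient (A B : comNzRingType)
    (phi : {rmorphism A -> B}) (k : nat) (x y : 'I_k -> A) :
  phi (telescoping_quotient x y)
    = telescoping_quotient (phi \o x) (phi \o y).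
Proof.
rewrite rmorph_sum; apply: eq_bigr => m _; rewrite rmorph_prod.
by apply: eq_bigr => l _; case: ifP.
Qed.

Lemma dhomog_prod1 (K : fieldType) (n : nat) (I : finType) (P : pred I)
    (p : I -> {mpoly K[n]}) :
  (forall i, p i \is 1.-homog) ->
  \prod_(i | P i) p i \is #|P|.-homog.
Proof.
move=> p1; rewrite -sum1_card.
elim/big_rec2: _ => [|i d q _ qd]; first exact: dhomog1.
exact: dhomogM.
Qed.

Lemma dhomog_telescoping_quotient (K : fieldType) (n k : nat)
    (x y : 'I_k -> {mpoly K[n]}) :
  (forall i, x i \is 1.-homog) -> (forall i, y i \is 1.-homog) ->
  telescoping_quotient x y \is k.-1.-homog.
Proof.
move=> x1 y1; apply: rpred_sum => m _.
have := @dhomog_prod1 K n _ (predC1 m) (fun l => if (l < m)%N then x l else y l).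
by rewrite cardC1 card_ord; apply=> l; case: ifP.
Qed.

(** * Linear forms *)

Local Notation "p @@ v" := (meval (fun i => v ord0 i) p)
  (at level 10, only parsing).

Section LinearForms.
Variables (K : fieldType) (n : nat).
Implicit Types (f g h p : {mpoly K[n]}) (v : 'rV[K]_n).

Lemma linear_formE p : p \is 1.-homog -> p = \sum_i p@_U_(i) *: 'X_i.
Proof.
move=> p1; apply/mpolyP => m; rewrite linear_sum /=.
under eq_bigr => i _ do rewrite linearZ /= mcoeffX.
have [/mdeg1P[i /eqP ->]|m1] := boolP (mdeg m == 1%N).
  rewrite (bigD1 i) //= eqxx mulr1 big1 ?addr0 // => j ji.
  by rewrite eq_mnm1 (negPf ji) mulr0.
rewrite (dhomog_nemf_coeff p1) // big1 // => i _; case: eqP => [im|_].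
  by rewrite -im mdeg1 in m1.
by rewrite mulr0.
Qed.

Definition coef_col p : 'cV[K]_n := \col_i p@_U_(i).

Lemma meval_linear p v :
  p \is 1.-homog -> p @@ v = (v *m coef_col p) ord0 ord0.
Proof.
move=> /linear_formE {1}->; rewrite linear_sum mxE; apply: eq_bigr => i _.
by rewrite /= mevalZ mevalXU mxE mulrC.
Qed.

Lemma meval_linear0 p : p \is 1.-homog -> p @@ (0 : 'rV[K]_n) = 0.
Proof. by move=> p1; rewrite meval_linear // mul0mx mxE. Qed.

(** Duality between subspaces and their annihilators: the columns of the
    cokernel of the matrix with rows [f] and [g] are common zeros of [f] and
    [g], and a row that kills them all lies in the row space. *)
Lemma linear_form_comb f g h :
  f \is 1.-homog -> g \is 1.-homog -> h \is 1.-homog ->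
  (forall v, f @@ v = 0 -> g @@ v = 0 -> h @@ v = 0) ->
  exists a b : K, h = a *: f + b *: g.
Proof.
move=> f1 g1 h1 fgh; pose r p := (coef_col p)^T.
pose B := (r f + r g)%MS.
have evC p j : p \is 1.-homog ->
    p @@ (row j (cokermx B)^T) = (r p *m cokermx B) ord0 j.
  by move=> p1; rewrite meval_linear // -row_mul !mxE; apply: eq_bigr => l _;
     rewrite !mxE mulrC.
have : (r h <= B)%MS.
  rewrite submxE; apply/eqP/rowP => j; rewrite -evC // mxE.
  have sub0 p : p \is 1.-homog -> (r p <= B)%MS ->
      p @@ (row j (cokermx B)^T) = 0.
    by move=> p1; rewrite submxE evC // => /eqP ->; rewrite mxE.
  by apply: fgh; apply: sub0; rewrite // ?addsmxSl ?addsmxSr.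
case/sub_addsmxP=> -[u w] /= /rowP e; exists (u ord0 ord0), (w ord0 ord0).
rewrite (linear_formE h1) [in RHS](linear_formE f1) [in RHS](linear_formE g1).
rewrite !scaler_sumr -big_split; apply: eq_bigr => i _ /=.
have := e i; rewrite !scalerA -scalerDl !mxE !big_ord1 !mxE => ->.
by [].
Qed.

(** The restriction of polynomials to the zeros of [f] is made a morphism to
    an integral domain by substituting a linear parametrisation of these
    zeros, the row space of the kernel of [f], for the variables. *)
Lemma restrict_to_zeros f : f \is 1.-homog ->
  exists phi : {rmorphism {mpoly K[n]} -> {mpoly K[n]}},
    phi f = 0 /\ forall p, phi p = 0 -> forall v, f @@ v = 0 -> p @@ v = 0.
Proof.
move=> f1; pose N := kermx (coef_col f).
pose t := [tuple \sum_l N l i *: ('X_l : {mpoly K[n]}) | i < n].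
exists (comp_mpoly t); split=> [|p p0 v fv].
  rewrite /= (linear_formE f1) rmorph_sum /=.
  under eq_bigr => i _ do
    rewrite comp_mpolyZ comp_mpolyXU -tnth_nth tnth_mktuple scaler_sumr.
  rewrite exchange_big big1 // => l _ /=.
  have /matrixP/(_ l ord0) : N *m coef_col f = 0 by exact: mulmx_ker.
  rewrite !mxE => NC; rewrite -[RHS](scale0r 'X_l) -NC scaler_suml.
  by apply: eq_bigr => i _; rewrite scalerA [coef_col f i _]mxE mulrC.
have /submxP[u vE] : (v <= N)%MS.
  apply/sub_kermxP/matrixP => i j; rewrite !ord1 -meval_linear // mxE.
  exact: fv.
have := comp_mpoly_meval (fun i => u ord0 i) p t.
rewrite p0 meval0 => /esym pu; rewrite -[RHS]pu; apply: meval_eq => i.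
rewrite tnth_mktuple vE mxE linear_sum; apply: eq_bigr => l _.
by rewrite /= mevalZ mevalXU mulrC.
Qed.

End LinearForms.

(** * Zero loci in projective space *)

Section Points.
Variables (K : fieldType) (n : nat).
Implicit Types (f g h p : {mpoly K[n.+1]}) (v : 'rV[K]_n.+1).

Lemma dim_line v : v != 0 -> \dim <[v]>%VS == 1%N.
Proof. by move=> v0; rewrite dim_vline v0. Qed.

Definition proj_point v (v0 : v != 0) : proj_space K n :=
  exist _ <[v]>%VS (dim_line v0).

Lemma zero_locus_point p v (v0 : v != 0) : p \is 1.-homog ->
  zero_locus p (proj_point v0) <-> p @@ v = 0.
Proof.
move=> p1; split=> [|pv w [/= /vlineP[c ->] _]].
  by apply; split; rewrite //= memv_line.
rewrite meval_linear // -scalemxAl mxE -meval_linear // pv mulr0.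
by [].
Qed.

(** Passes from points to vectors; the zero vector, which represents no point,
    is a zero of every linear form. *)
Lemma zero_locusI_sub f g h :
  f \is 1.-homog -> g \is 1.-homog -> h \is 1.-homog ->
  zero_locus f `&` zero_locus g `<=` zero_locus h ->
  forall v, f @@ v = 0 -> g @@ v = 0 -> h @@ v = 0.
Proof.
move=> f1 g1 h1 sub v fv gv; have [->|v0] := eqVneq v 0.
  exact: meval_linear0.
by apply/(zero_locus_point v0 h1)/sub; split; apply/zero_locus_point.
Qed.

Lemma zero_locusZ p (c : K) : c != 0 -> zero_locus (c *: p) = zero_locus p.
Proof.
move=> c0; apply/seteqP; split=> x px v xv; last by rewrite mevalZ px ?mulr0.
by have /eqP := px v xv; rewrite mevalZ mulf_eq0 (negPf c0) => /eqP.
Qed.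

(** A linear subspace of projective space has a well-defined dimension,
    because its points span the underlying vector space. *)
Lemma linear_subspace_dim (d e : nat) (A : set (proj_space K n)) :
  linear_subspace d A -> linear_subspace e A -> d = e.
Proof.
move=> [U [dU ->]] [W [dW UW]]; apply: succn_inj; rewrite -dU -dW.
have sub (V V' : {vspace 'rV[K]_n.+1}) :
    [set x : proj_space K n | (val x <= V)%VS]
      `<=` [set x | (val x <= V')%VS] -> (V <= V')%VS.
  move=> VV'; apply/subvP => v vV; have [->|v0] := eqVneq v 0.
    exact: mem0v.
  by rewrite memvE; apply: (VV' (proj_point v0)); rewrite /= -memvE.
by congr (\dim _); apply/eqP; rewrite eqEsubv !sub ?UW.
Qed.

End Points.

(** * The hypersurface of residual planes *)
Theorem proposition1 (R : realType) (k : nat) (hk : (1 <= k)%N)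
    (F G : 'I_k -> set (proj_space (complex R) 4))
    (H : set (proj_space (complex R) 4))
    (f g : 'I_k -> {mpoly (complex R)[5]}) (h : {mpoly (complex R)[5]})
    (F_hyp : forall i, hyperplane (F i))
    (G_hyp : forall j, hyperplane (G j))
    (H_hyp : hyperplane H)
    (f_lin : forall i, is_form 1 (f i))
    (g_lin : forall j, is_form 1 (g j))
    (h_lin : is_form 1 h)
    (F_eq : forall i, F i = zero_locus (f i))
    (G_eq : forall j, G j = zero_locus (g j))
    (H_eq : H = zero_locus h)
    (Pi_plane : forall i j, plane (F i `&` G j))
    (s : 'S_k)
    (Pi_sub_H : forall i, F i `&` G (s i) `<=` H)
    (H_neq_F : forall i, H <> F i)
    (H_neq_G : forall i, H <> G (s i)) :
  (exists a b : 'I_k -> complex R, normalization s f g h a b) /\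
  (forall a b : 'I_k -> complex R, normalization s f g h a b ->
    exists q : {mpoly (complex R)[5]},
      [/\ \prod_(i < k) (a i *: f i)
            - (-1) ^+ k * \prod_(j < k) (b j *: g j) = q * h,
          is_form k.-1 q
        & forall i j, j != s i -> F i `&` G j `<=` zero_locus q]).
Proof.
have f1 i : f i \is 1.-homog by case: (f_lin i).
have g1 j : g j \is 1.-homog by case: (g_lin j).
have [h1 h0] := h_lin.
split.
  have comb i : exists c : complex R * complex R,
      [/\ c.1 != 0, c.2 != 0 & h = c.1 *: f i + c.2 *: g (s i)].
    have [|a [b hE]] := linear_form_comb (f1 i) (g1 (s i)) h1.
      by apply: zero_locusI_sub; rewrite // -F_eq -G_eq -H_eq.
    have neq0 (c d : complex R) (p q : {mpoly (complex R)[5]}) :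
        h = c *: p + d *: q -> H <> zero_locus q -> c != 0.
      move=> hpq Hq; apply/eqP => c0; apply: Hq.
      move: hpq; rewrite c0 scale0r add0r H_eq => hq; rewrite hq zero_locusZ //.
      by apply: contraNneq h0 => d0; rewrite hq d0 scale0r.
    exists (a, b); split=> //=.
      by apply: (neq0 _ _ _ _ hE); rewrite -G_eq.
    by rewrite addrC in hE; apply: (neq0 _ _ _ _ hE); rewrite -F_eq.
  have [c cP] := fin_all_exists comb.
  (* The second family is indexed by j = s i. *)
  exists (fun i => (c i).1), (fun j => (c (s^-1%g j)).2).
  split=> [i|j|i]; first by case: (cP i).
    by case: (cP (s^-1%g j)).
  by rewrite permK; case: (cP i).
move=> a b [a0 b0 hE].
pose x i := a i *: f i; pose y i := - (b (s i) *: g (s i)).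
have xyh i : x i - y i = h by rewrite opprK -hE.
have prod_y : \prod_i y i = (-1) ^+ k * \prod_j (b j *: g j).
  by rewrite prodrN card_ord [in RHS](reindex_inj (@perm_inj _ s)).
have qh : \prod_(i < k) (a i *: f i) - (-1) ^+ k * \prod_(j < k) (b j *: g j)
    = telescoping_quotient x y * h.
  by rewrite -prod_y; apply: prodrB_telescoping.
exists (telescoping_quotient x y); split=> //.
  split.
    apply: dhomog_telescoping_quotient => i; first exact: dhomogZ.
    by rewrite rpredN; exact: dhomogZ.
  pose i0 := Ordinal hk; have [phi [phif phi_inj]] := restrict_to_zeros (f1 i0).
  have phig j : phi (b j *: g j) != 0.
    apply/eqP => gj0.
    suff FG : F i0 `&` G j = F i0.
      by have := Pi_plane i0 j; rewrite FG => /(linear_subspace_dim (F_hyp i0)).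
    apply/setIidl => z; rewrite F_eq G_eq => fz v zv.
    have /eqP := phi_inj _ gj0 v (fz v zv).
    by rewrite mevalZ mulf_eq0 (negPf (b0 j)) => /eqP.
  apply/eqP => q0; move: qh; rewrite q0 mul0r => /(congr1 phi).
  rewrite rmorphB rmorphM rmorphXn rmorphN rmorph1 !rmorph_prod rmorph0.
  rewrite (bigD1 i0) //= -mul_mpolyC rmorphM phif mulr0 mul0r sub0r => /eqP.
  rewrite oppr_eq0 mulf_eq0 signr_eq0 => /prodf_eq0[j _].
  by rewrite (negPf (phig j)).
move=> i j ji z [Fz Gz] v zv.
have fv : f i @@ v = 0 by move: Fz; rewrite F_eq; apply.
have gv : g j @@ v = 0 by move: Gz; rewrite G_eq; apply.
have xi : x i @@ v = 0 by rewrite mevalZ fv mulr0.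
have yj : y (s^-1%g j) @@ v = 0 by rewrite mevalN mevalZ permKV gv mulr0 oppr0.
(* Where h vanishes, dividing by h gives nothing: the vanishing is read off
   the explicit quotient, at the indices i and s^-1 j. *)
have [hv|hv] := eqVneq (h @@ v) 0.
  have xy l : x l @@ v = y l @@ v.
    by apply/eqP; rewrite -subr_eq0 -mevalB xyh hv.
  have ij : i != s^-1%g j by apply: contraNneq ji => ->; rewrite permKV.
  have yi : y i @@ v = 0 by rewrite -xy.
  have xj : x (s^-1%g j) @@ v = 0 by rewrite xy.
  rewrite rmorph_telescoping_quotient.
  exact: telescoping_quotient_eq0 ij xi yi xj yj.
have /(congr1 (meval (fun l => v ord0 l))) := qh.
rewrite mevalB !mevalM !rmorph_prod (bigD1 i) //= -/(x i) xi mul0r.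
rewrite (bigD1 j) //= mevalZ gv mulr0 mul0r mulr0 subrr => /esym/eqP.
by rewrite mulf_eq0 (negPf hv) orbF => /eqP.
Qed.
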